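(* Let $G$ be a graph that is nonempty (i.e. has at least one edge), let $r\ge 0$ be an integer, and let $t=\chi(\mathcal M^r(G))$. Suppose that $t$ is odd and that the length of the shortest odd cycle of $G$ (its odd girth, taken to be $\infty$ if $G$ has no odd cycle) is strictly greater than $t$. Then $\alpha^\circ(\mathcal M^r(G))<t$.
   Context: All graphs are finite, undirected and simple; $\chi$ denotes the chromatic number. The length of a cycle is its number of vertices (equivalently edges). Circular altitude. A circular ordering $\sigma$ of $V(G)$ is a one-to-one assignment of $V(G)$ to the vertices of a directed cycle. A cycle $u_1,u_2,\ldots,u_n$ of $G$ is monotonic for $\sigma$ if $u_1,\ldots,u_n,u_1$ appear in this circular order in $\sigma$. Edges of $G$ are regarded as monotonic cycles of length two. The circular altitude $\alpha^\circ(G)$ of a graph $G$ with at least one edge is the largest $k$ such that every circular ordering of $V(G)$ contains a monotonic cycle of length at least $k$. Mycielskian. Given a graph $G$, the Mycielskian $\mathcal M(G)$ has vertex set $\{w\}\cup\{a^u \mid a\in V(G)\}\cup\{a^v\mid a\in V(G)\}$ (all these vertices distinct; $u,v$ are formal labels). Its edges are: $a^v b^v$, $a^u b^v$ and $b^u a^v$ for every edge $ab$ of $G$, and $w a^u$ for every $a\in V(G)$; there are no other edges. $\mathcal M^0(G)=G$ and $\mathcal M^{d}(G)=\mathcal M(\mathcal M^{d-1}(G))$ for $d\ge 1$. *)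

(* Defs.v *)
From mathcomp Require Import all_boot.

Set Implicit Arguments.
Unset Strict Implicit.
Unset Printing Implicit Defensive.

Record sgraph := SGraph {
  vertex :> finType;
  adj : rel vertex;
  adj_sym : symmetric adj;
  adj_irrefl : irreflexive adj
}.

Definition has_edge (G : sgraph) := exists x y : G, adj x y.

Section Coloring.
Variable G : sgraph.

Definition proper_coloring k (f : {ffun G -> 'I_k}) :=
  [forall x, forall y, adj x y ==> (f x != f y)].

Definition colorable k := [exists f : {ffun G -> 'I_k}, proper_coloring f].

Lemma colorable_card : exists k, colorable k.
Proof.
exists #|G|; apply/existsP; exists [ffun x => enum_rank x].
apply/forallP => x; apply/forallP => y; apply/implyP => xy.
rewrite !ffunE (inj_eq enum_rank_inj).
by apply: contraTneq xy => ->; rewrite adj_irrefl.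
Qed.

Definition chromatic_number := ex_minn colorable_card.

End Coloring.

Section Cycles.
Variable G : sgraph.

Definition graph_cycle (c : seq G) := (2 < size c) && ucycleb (@adj G) c.

Definition is_edge (c : seq G) := if c is [:: x; y] then adj x y else false.

Definition has_odd_cycle n :=
  odd n && [exists c : n.-tuple G, graph_cycle c].

(* [None] stands for infinity. *)
Definition odd_girth : option nat :=
  if [pick n : 'I_#|G|.+1 | has_odd_cycle n] is Some n0
  then Some (val [arg min_(n < n0 | has_odd_cycle n) n])
  else None.

(* [circular_order s] is an assignment of the vertices to the directed cycle
   0 -> 1 -> ... -> #|G|.-1 -> 0; it is a bijection, by cardinality. *)
Definition circular_order (s : {ffun G -> 'I_#|G|}) := injectiveb s.

(* Going once around the directed cycle from 0, one meets the vertices of [c]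
   in the listed order, up to the choice of the first one. *)
Definition in_circular_order (s : {ffun G -> 'I_#|G|}) (c : seq G) :=
  [exists i : 'I_(size c), sorted (fun x y : G => s x < s y) (rot i c)].

Definition monotonic_cycle s (c : seq G) :=
  graph_cycle c && in_circular_order s c || is_edge c.

Definition has_long_monotonic_cycles k :=
  [forall (s : {ffun G -> 'I_#|G|} | circular_order s),
   exists n : 'I_#|G|.+1, (k <= n) &&
   [exists c : n.-tuple G, monotonic_cycle s c]].

(* Cycles have at most #|G| vertices, so bounding [k] and [n] loses nothing:
   see [leq_circular_altitude]. The value is junk (0) for an edgeless graph. *)
Definition circular_altitude :=
  \max_(k < #|G|.+1 | has_long_monotonic_cycles k) k.

End Cycles.

Definition ltn_inf (t : nat) (g : option nat) :=
  if g is Some n then t < n else true.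

(* None is w, Some (inl a) is a^u and Some (inr a) is a^v. *)
Definition myc_adj (G : sgraph) : rel (option (G + G)) := fun x y =>
  match x, y with
  | Some (inr a), Some (inr b) => adj a b
  | Some (inl a), Some (inr b) => adj a b
  | Some (inr a), Some (inl b) => adj a b
  | None, Some (inl _) => true
  | Some (inl _), None => true
  | _, _ => false
  end.

Lemma myc_adj_sym G : symmetric (@myc_adj G).
Proof. by move=> [[a|a]|] [[b|b]|] //=; rewrite adj_sym. Qed.

Lemma myc_adj_irrefl G : irreflexive (@myc_adj G).
Proof. by move=> [[a|a]|] //=; rewrite adj_irrefl. Qed.

Definition mycielskian (G : sgraph) : sgraph :=
  SGraph (@myc_adj_sym G) (@myc_adj_irrefl G).

Lemma uniq_size_card (G : sgraph) (c : seq G) : uniq c -> size c < #|G|.+1.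
Proof. by move=> /card_uniqP <-; rewrite ltnS max_card. Qed.

Lemma ltn_odd_girth (G : sgraph) t :
  ltn_inf t (odd_girth G) <->
  (forall c : seq G, graph_cycle c -> odd (size c) -> t < size c).
Proof.
have ocP (c : seq G) : graph_cycle c -> odd (size c) -> has_odd_cycle G (size c).
  by move=> hc ho; rewrite /has_odd_cycle ho; apply/existsP; exists (in_tuple c).
rewrite /odd_girth; case: pickP => [n0 h0 | hN] /=; last first.
  split=> // _ c hc ho; have /andP[_ /andP[_ uc]] := hc.
  by have := hN (Ordinal (uniq_size_card uc)); rewrite /= ocP.
case: arg_minnP => // n /andP[on /existsP[c hc]] hmin; split=> [tn c' hc' ho | h].
  have /andP[_ /andP[_ uc]] := hc'.
  exact: leq_trans tn (hmin (Ordinal (uniq_size_card uc)) (ocP _ hc' ho)).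
by have := h _ hc; rewrite size_tuple; apply.
Qed.

Lemma leq_circular_altitude (G : sgraph) k : has_edge G ->
  k <= circular_altitude G <->
  (forall s : {ffun G -> 'I_#|G|}, injective s ->
     exists2 c : seq G, monotonic_cycle s c & k <= size c).
Proof.
move=> [x [y xy]].
have usz (s : {ffun G -> 'I_#|G|}) (c : seq G) :
    monotonic_cycle s c -> size c < #|G|.+1.
  case/orP=> [/andP[/andP[_ /andP[_ uc]] _]|]; first exact: uniq_size_card.
  case: c => [|a [|b []]] //= ab; apply: (@uniq_size_card _ [:: a; b]).
  by rewrite /= inE andbT; apply: contraTneq ab => ->; rewrite adj_irrefl.
have longP j : reflect (forall s : {ffun G -> 'I_#|G|}, injective s ->
     exists2 c : seq G, monotonic_cycle s c & j <= size c)
     (has_long_monotonic_cycles G j).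
  apply: (iffP forallP) => [h s /injectiveP si | h s].
    have /existsP[n /andP[jn /existsP[c hc]]] := implyP (h s) si.
    by exists c; rewrite ?size_tuple.
  apply/implyP => /injectiveP si; have [c hc jc] := h s si.
  apply/existsP; exists (Ordinal (usz _ _ hc)); rewrite /= jc /=.
  by apply/existsP; exists (in_tuple c).
split=> [hk s si | h].
  have h0 : has_long_monotonic_cycles G (ord0 : 'I_#|G|.+1).
    by apply/longP => s' _; exists [:: x; y]; rewrite // /monotonic_cycle /= xy orbT.
  have [j hj ej] := eq_bigmax_cond (fun i : 'I_#|G|.+1 => val i)
    (A := fun i : 'I_#|G|.+1 => has_long_monotonic_cycles G i)
    (introT card_gt0P (ex_intro _ ord0 h0)).
  have [c hc jc] := longP _ hj s si; exists c => //.
  by apply: leq_trans hk (leq_trans _ jc); rewrite -[leqRHS]ej.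
have [c hc kc] := h [ffun z => enum_rank z]
  (fun a b => ltac:(rewrite !ffunE; exact: enum_rank_inj)).
pose K := Ordinal (leq_ltn_trans kc (usz _ _ hc)).
by apply: (@leq_bigmax_cond _ _ (fun i : 'I_#|G|.+1 => val i) K); apply/longP.
Qed.

(* Main.v *)
(** From a [t]-coloring of [M^r(G)] one gets a [k]-coloring [f] of [G] with
    [t = k + r].  Color [M^r(G)] afresh with [k + r] colors: a copy of the apex
    [w] created at step [j] gets color [j - 1]; a copy of a vertex [a] of [G]
    gets [k + i - 1] if the last label [u] in it was acquired at step [i], and
    [f a] if it has no label [u].  Order the vertices by color.  A monotonic
    cycle of length at least [t] then meets the colors [0, ..., t - 1] in turn.
    A copy of an apex of color [j] is adjacent to copies of vertices of [G] only
    if their color is at least [k + j > j + 1], and color [t - 1] is used only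
    on copies of vertices of [G]; going down from [t - 1], the cycle contains no
    copy of an apex.  It thus projects to a closed walk of odd length [t] in
    [G], which contains an odd cycle. *)
Require Import Defs.
From mathcomp Require Import all_boot.

Set Implicit Arguments.
Unset Strict Implicit.
Unset Printing Implicit Defensive.

Lemma colorableP (G : sgraph) k :
  reflect (exists2 f : G -> nat, forall x, f x < k
             & forall x y : G, adj x y -> f x != f y)
          (colorable G k).
Proof.
apply: (iffP existsP) => [[f /forallP pf] | [f fk pf]].
  exists (fun x => val (f x)) => [x | x y xy]; first exact: ltn_ord.
  by have /forallP/(_ y)/implyP/(_ xy) := pf x; apply: contra => /eqP/val_inj->.
exists [ffun x => Ordinal (fk x)]; apply/forallP => x; apply/forallP => y.
by apply/implyP => /pf; rewrite !ffunE.
Qed.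

(** Each [v a] sharing the color of [w] takes that of [u a] instead. No two adjacent vertices are
    both changed, so the result is proper and avoids the color of [w], which [unbump] then removes
    from the range. *)
Lemma colorable_mycielskian (G : sgraph) n :
  colorable (mycielskian G) n -> exists2 m, n = m.+1 & colorable G m.
Proof.
case/colorableP=> f fn pf; set w : mycielskian G := None.
case: n => [|m] in fn *; first by have := fn w.
exists m => //; apply/colorableP.
pose u a : mycielskian G := Some (inl a).
pose v a : mycielskian G := Some (inr a).
pose g a := if f (v a) == f w then f (u a) else f (v a).
have g_w a : g a != f w.
  by rewrite /g; case: ifP => [_|->] //; apply: pf.
have g_adj a b : adj a b -> g a != g b.
  rewrite /g => ab; case: ifP => [/eqP va|_]; case: ifP => [/eqP vb|_].
  - by have := pf (v a) (v b) ab; rewrite va vb eqxx.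
  - exact: pf.
  - exact: pf.
  - exact: pf.
exists (fun a => unbump (f w) (g a)) => [a | a b /g_adj]; last first.
  by apply: contra => /eqP e; rewrite -(@unbumpK (f w) (g a)) ?e ?unbumpK ?inE.
have ga : g a < m.+1 by rewrite /g; case: ifP.
have := g_w a; rewrite /unbump; case: (ltngtP (f w) (g a)) => //= h _.
  by rewrite subn1 -ltnS prednK // (leq_ltn_trans _ h).
by rewrite subn0; apply: leq_trans h _; rewrite -ltnS.
Qed.

Lemma colorable_iter_mycielskian (G : sgraph) r n :
  colorable (iter r mycielskian G) n -> exists2 k, n = k + r & colorable G k.
Proof.
elim: r n => [|r IHr] n /=; first by exists n; rewrite ?addn0.
by case/colorable_mycielskian=> m -> /IHr[k -> ck]; exists k; rewrite ?addnS.
Qed.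

Lemma has_edge_colorable (G : sgraph) k : has_edge G -> colorable G k -> 1 < k.
Proof.
case=> x [y xy] /colorableP[f fk /(_ x y xy)].
by have := fk x; have := fk y; case: k {fk} => [|[]] //; case: (f x); case: (f y).
Qed.

Lemma has_edge_iter_mycielskian (G : sgraph) r :
  has_edge G -> has_edge (iter r mycielskian G).
Proof.
by move=> hG; elim: r => //= r [x [y xy]]; exists (Some (inr x)), (Some (inr y)).
Qed.

(** A repeated vertex cuts a closed walk into two shorter ones, and one of them is odd. *)
Lemma odd_closed_walk_cycle (G : sgraph) (p : seq G) :
  cycle (@adj G) p -> odd (size p) ->
  exists c : seq G, [/\ graph_cycle c, odd (size c) & size c <= size p].
Proof.
have [n] := ubnP (size p); elim: n p => // n IHn p pn cp op.
have [up | nup] := boolP (uniq p).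
  exists p; split=> //; rewrite /graph_cycle /ucycleb cp up !andbT.
  by case: p cp op {IHn pn up} => [|x [|y []]] //=; rewrite adj_irrefl.
have [x [p1 [p2 [p3 ep]]]] : exists x p1 p2 p3, p = p1 ++ x :: p2 ++ x :: p3.
  elim: p nup {IHn pn cp op} => //= x p IHp; have [/splitPr[p2 p3] _|_] := boolP (x \in p).
    by exists x, [::], p2, p3.
  by case/IHp=> y [p1 [p2 [p3 ->]]]; exists y, (x :: p1), p2, p3.
(* Rotated to start at the first of the two [x], the walk splits at the second. *)
have [cp2 cp31] : cycle (@adj G) (x :: p2) /\ cycle (@adj G) (x :: p3 ++ p1).
  move: cp; rewrite -(rot_cycle (size p1)) ep rot_size_cat /= -catA /= rcons_cat /=.
  by rewrite cat_path /= andbA -rcons_path => /andP[].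
have sp : size p = size (x :: p2) + size (x :: p3 ++ p1).
  by rewrite -size_cat -(size_rot (size p1)) ep rot_size_cat /= -!catA.
have [o2|e2] := boolP (odd (size (x :: p2))).
  have [|c [gc oc sc]] := IHn (x :: p2) _ cp2 o2.
    by rewrite -ltnS (leq_ltn_trans _ pn) // sp /= addnS ltnS leq_addr.
  by exists c; split=> //; apply: leq_trans sc _; rewrite sp leq_addr.
have [|| c [gc oc sc]] := IHn (x :: p3 ++ p1) _ cp31.
- by rewrite -ltnS (leq_ltn_trans _ pn) // sp /= addSn ltnS leq_addl.
- by move: op; rewrite sp oddD (negbTE e2).
- by exists c; split=> //; apply: leq_trans sc _; rewrite sp leq_addl.
Qed.

Section ApexColoring.
Variables (G : sgraph) (f : G -> nat) (k : nat).

(** A partial projection to [G]: [None] marks the copies of an apex. *)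
Fixpoint origin r : iter r mycielskian G -> option G :=
  match r return iter r mycielskian G -> option G with
  | 0 => fun x => Some x
  | r'.+1 => fun x : option (iter r' mycielskian G + iter r' mycielskian G) =>
      match x with
      | None => None
      | Some (inl a) | Some (inr a) => origin a
      end
  end.

Fixpoint apex_color r : iter r mycielskian G -> nat :=
  match r return iter r mycielskian G -> nat with
  | 0 => fun x => f x
  | r'.+1 => fun x : option (iter r' mycielskian G + iter r' mycielskian G) =>
      match x with
      | None => r'
      | Some (inl a) => if origin a then k + r' else apex_color a
      | Some (inr a) => apex_color a
      end
  end.

Hypotheses (f_lt : forall x, f x < k)
           (f_adj : forall x y : G, adj x y -> f x != f y).

Lemma adj_origin r (x y : iter r mycielskian G) a b :
  adj x y -> origin x = Some a -> origin y = Some b -> adj a b.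
Proof.
elim: r x y => [|r IHr] /=; first by move=> x y xy [<-] [<-].
by move=> [[x|x]|] [[y|y]|] //; apply: IHr.
Qed.

Lemma apex_color_lt_apex r (x : iter r mycielskian G) :
  origin x = None -> apex_color x < r.
Proof.
elim: r x => [|r IHr] //= [[x|x]|] //= ox; rewrite ?ox ltnW // ltnS IHr //.
Qed.

Lemma apex_color_lt r (x : iter r mycielskian G) : apex_color x < k + r.
Proof.
elim: r x => [|r IHr] /= x; first by rewrite addn0.
rewrite addnS ltnS.
case: x => [[x|x]|]; last exact: leq_addl.
  by case: ifP => // _; apply: ltnW.
exact: ltnW.
Qed.

(** At step [r.+1] the new apex, colored [r], meets such copies in color [k + r]. Later steps keep
    the color of the apex copy, and keep the other one or raise it to a new maximum. *)
Lemma apex_color_adj_apex r (x y : iter r mycielskian G) :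
  adj x y -> origin x = None -> origin y -> k + apex_color x <= apex_color y.
Proof.
elim: r x y => [|r IHr] //= [[x|x]|] [[y|y]|] //= xy ox oy.
- by rewrite ox IHr.
- by rewrite oy leq_add2l ltnW ?apex_color_lt_apex.
- exact: IHr.
- by rewrite oy.
Qed.

(** Color [k + r] is new at step [r.+1], so it differs from those of the [v] copies and, as [0 < k],
    from the color [r] of the new apex. The [u] copies that keep their color come from older apexes,
    colored below [r]. *)
Lemma apex_color_adj r (x y : iter r mycielskian G) :
  0 < k -> adj x y -> apex_color x != apex_color y.
Proof.
move=> k_gt0.
elim: r x y => [|r IHr] /=; first exact: f_adj.
have uv (x y : iter r mycielskian G) : adj x y ->
    (if origin x then k + r else apex_color x) != apex_color y.
  by case: ifP => _; [rewrite gtn_eqF ?apex_color_lt | apply: IHr].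
have uw (x : iter r mycielskian G) :
    (if origin x then k + r else apex_color x) != r.
  case ox: (origin x) => [a|]; last by rewrite ltn_eqF ?apex_color_lt_apex.
  by rewrite gtn_eqF // -[ltnLHS]add0n ltn_add2r.
move=> [[x|x]|] [[y|y]|] //= xy; rewrite ?uv ?uw ?IHr // eq_sym ?uw //.
by rewrite uv // adj_sym.
Qed.

Lemma path_apex_free r m (c : seq (iter r mycielskian G)) :
  1 < k -> sorted (@adj _) c -> map (@apex_color r) c = iota m (size c) ->
  m + size c = k + r -> all (fun x => isSome (origin x)) c.
Proof.
move=> k_gt1; elim: c m => //= x c IHc m sc [xm mc]; rewrite -addSnnS => mr.
have /allP ac := IHc m.+1 (path_sorted sc) mc mr.
apply/andP; split; last exact/allP.
case ox: (origin x) => //; case: c sc mc mr ac {IHc} => [|y c] /=.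
  (* Here [x] is last, of color [k + r - 1 >= r], too large for a copy of an apex. *)
  rewrite addn0 -xm => _ _ e _; have := apex_color_lt_apex ox.
  by rewrite -ltnS e ltnS -{2}[r]add0n leq_add2r leqNgt ltnW.
case/andP=> xy _ [ym _] _ ac.
have := apex_color_adj_apex xy ox (ac y (mem_head _ _)).
by rewrite ym xm -add1n leq_add2r leqNgt k_gt1.
Qed.

End ApexColoring.

Lemma order_by (T : finType) (F : T -> nat) :
  exists2 s : {ffun T -> 'I_#|T|}, injective s
    & forall x y, s x < s y -> F x <= F y.
Proof.
pose L := sort (relpre F leq) (enum T).
have memL x : x \in L by rewrite mem_sort mem_enum.
have ltL x : index x L < #|T|.
  by rewrite cardE -(size_sort (relpre F leq)) index_mem memL.
exists [ffun x => Ordinal (ltL x)] => x y; rewrite !ffunE.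
  by case=> /(congr1 (nth x L)); rewrite !nth_index.
move=> /= /ltnW; apply: (@sorted_leq_index _ (relpre F leq)) => //.
- by move=> ? ? ?; apply: leq_trans.
- by move=> ?; apply: leqnn.
- by apply: sort_sorted => ? ?; apply: leq_total.
Qed.

(** Without repetition, at least [n] entries below [n] exhaust [iota 0 n]. Hence a long monotonic
    cycle meets every color exactly once. *)
Lemma sorted_ltn_iota (l : seq nat) n :
  sorted ltn l -> all (gtn n) l -> n <= size l -> l = iota 0 n.
Proof.
move=> sl /allP ln nl.
apply: (irr_sorted_eq ltn_trans ltnn sl (iota_ltn_sorted 0 n)).
have ul := sorted_uniq ltn_trans ltnn sl.
have sub : {subset l <= iota 0 n} by move=> i /ln; rewrite mem_iota.
by have [] := uniq_min_size ul sub; rewrite ?size_iota.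
Qed.

Theorem theorem1p1 (G : sgraph) (r t : nat)
    (G_nonempty : has_edge G)
    (t_def : t = chromatic_number (iter r mycielskian G))
    (t_odd : odd t)
    (t_girth : ltn_inf t (odd_girth G)) :
  circular_altitude (iter r mycielskian G) < t.
Proof.
have : colorable (iter r mycielskian G) t.
  by rewrite t_def /chromatic_number; case: ex_minnP.
case/colorable_iter_mycielskian=> k tE Gk.
have k_gt1 := has_edge_colorable G_nonempty Gk.
case/colorableP: Gk => f f_lt f_adj.
pose F := @apex_color G f k r.
have [s s_inj sF] := order_by F.
rewrite ltnNge; apply/negP.
case/(leq_circular_altitude _ (has_edge_iter_mycielskian r G_nonempty))/(_ s s_inj).
move=> c; case/orP=> [/andP[/andP[_ /andP[adj_c _]] /existsP[i s_d]] | edge_c] tc.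
  set d := rot i c in s_d.
  have cycle_d : cycle (@adj _) d by rewrite rot_cycle.
  have sorted_d : sorted (@adj _) d.
    by case: (d) cycle_d => //= x p; rewrite rcons_path => /andP[].
  have F_d : map F d = iota 0 t.
    (* Colors weakly increase along [d] by the choice of [s], and strictly because consecutive
       vertices are adjacent. *)
    apply: sorted_ltn_iota; last by rewrite size_map size_rot.
      rewrite sorted_map; move: sorted_d s_d; case: (d) => //= x p.
      elim: p x => //= y p IHp x /andP[xy yp] /andP[sxy syp].
      rewrite IHp // andbT ltn_neqAle sF // andbT.
      exact: (apex_color_adj f_lt f_adj) (ltnW k_gt1) xy.
    by apply/allP => _ /mapP[x _ ->]; rewrite /= tE; apply: apex_color_lt.
  have size_d : size d = t by rewrite -(size_map F) F_d size_iota.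
  have all_d : all (fun x => isSome (origin x)) d.
    by apply: (path_apex_free (f := f) k_gt1 sorted_d (m := 0)); rewrite size_d.
  (* The default [x0] only makes [h] total: by [all_d] it is never taken on [d]. *)
  have [x0 _] := G_nonempty; pose h (x : iter r mycielskian G) := odflt x0 (origin x).
  have cycle_h : cycle (@adj G) (map h d).
    apply: homo_cycle_in all_d cycle_d => x y.
    rewrite !unfold_in /h => ox oy xy; have := adj_origin xy.
    by case: (origin x) (origin y) ox oy => // a [b|] // _ _; apply.
  have [|e [ge oe]] := odd_closed_walk_cycle cycle_h; first by rewrite size_map size_d.
  by rewrite size_map size_d leqNgt (iffLR (ltn_odd_girth G t) t_girth).
(* An edge has length two, so [t <= 2]; with [1 < k <= t] this makes [t] even. *)
case: c edge_c tc => [|? [|? []]] //= _ t2.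
have := leq_trans k_gt1 (leq_addr r k); rewrite -tE => t1.
by move: t_odd; have /eqP-> : t == 2 by rewrite eqn_leq t2.
Qed.
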